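(* Let $G$ be a finite bipartite graph with maximum degree $\Delta(G)$, and let $m\ge 1$ be an integer. Let $M$ be a set of edges of the Cartesian product $G \square K_{1,m}$ such that the distance between any two distinct edges of $M$ is at least $2$, and let each edge of $M$ be assigned a color from $\{1,\dots,\Delta(G)+m\}$. Then this precoloring is extendable, i.e. there is a proper edge coloring of $G \square K_{1,m}$ with colors from $\{1,\dots,\Delta(G)+m\}$ (which is $\chi'(G\square K_{1,m})$ colors) in which every edge of $M$ receives its prescribed color.
   Context: $K_{1,m}$ is the star with $m$ leaves. The Cartesian product $G_1 \square G_2$ has vertex set $V(G_1)\times V(G_2)$, with $(u_1,u_2)$ adjacent to $(v_1,v_2)$ iff either $u_1=v_1$ and $u_2v_2\in E(G_2)$, or $u_2=v_2$ and $u_1v_1\in E(G_1)$. The distance between edges $e=xy$ and $f=zw$ is $\min\{d(x,z),d(x,w),d(y,z),d(y,w)\}$, where $d$ is the shortest-path distance between vertices; so edges at pairwise distance at least $2$ form an induced matching. A precoloring of an edge subset is extendable if there is a proper edge coloring of the whole graph with $\chi'$ (chromatic index) colors agreeing with the prescribed colors. *)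

(* Defs.v *)
From mathcomp Require Import all_boot.
Set Implicit Arguments.
Unset Strict Implicit.
Unset Printing Implicit Defensive.

Section Graphs.
Variables (T : finType) (e : rel T).

Definition simple_graph := symmetric e /\ irreflexive e.

Definition bipartite := exists A : {set T}, forall x y, e x y -> (x \in A) != (y \in A).

Definition max_degree := \max_(x : T) #|[set y | e x y]|.

Definition edge_set : {set {set T}} := [set [set p.1; p.2] | p : T * T & e p.1 p.2].

(* A distance is attained by a path without repeated vertices, hence is less   *)
(* than #|T|; [find] returns #|T| when y is not reachable from x, so #|T|      *)
(* plays the role of infinity.                                                 *)
Definition dist (x y : T) : nat :=
  find (fun n => [exists p : n.-tuple T, path e x p && (last x p == y)])
       (iota 0 #|T|).

Definition edge_dist (f g : {set T}) : nat :=
  \big[minn/#|T|]_(x in f) \big[minn/#|T|]_(z in g) dist x z.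

(* The palette is {1, ..., k}; the values of c outside edge_set are irrelevant. *)
Definition proper_edge_coloring (k : nat) (c : {set T} -> nat) : bool :=
  [forall f in edge_set, 0 < c f <= k] &&
  [forall f in edge_set, forall g in edge_set,
     (f != g) && ~~ [disjoint f & g] ==> (c f != c g)].

Definition edge_colorable (k : nat) : bool :=
  [exists c : {ffun {set T} -> 'I_k.+1}, proper_edge_coloring k (fun f => c f)].

Lemma edge_colorable_exists : exists k, edge_colorable k.
Proof.
exists #|{: {set T}}|; apply/existsP.
exists [ffun f => lift ord0 (enum_rank f)]; apply/andP; split.
  by apply/forall_inP=> f _; rewrite ffunE lift0 /= ltn_ord.
apply/forall_inP=> f _; apply/forall_inP=> g _; apply/implyP=> /andP[fg _].
by rewrite !ffunE !lift0 eqSS; apply: contraNneq fg => /ord_inj/enum_rank_inj->.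
Qed.

Definition chromatic_index : nat := ex_minn edge_colorable_exists.

End Graphs.

(* The centre is None and the leaves are Some i. *)
Definition star (m : nat) : rel (option 'I_m) :=
  fun x y => (x == None) != (y == None).
Arguments star m : clear implicits.

Definition cartesian_product (T1 T2 : finType) (e1 : rel T1) (e2 : rel T2) :
    rel (T1 * T2) :=
  fun u v => (u.1 == v.1) && e2 u.2 v.2 || (u.2 == v.2) && e1 u.1 v.1.

(* Main.v *)
(* Let K be the set of colours and fold one leaf copy of G onto the central     *)
(* copy. What remains of G [] K_{1,m} is G [] K_{1,m-1}, of maximum degree at   *)
(* most #|K| - 1, and M projects to a matching of it (apart from the spokes     *)
(* towards the folded copy, which project to vertices). Delete from the list of *)
(* each remaining edge the colours of the edges of M it meets. At most one edge *)
(* of M meets each end, and a matching edge also lowers the degree there, so    *)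
(* every list is at least as long as the larger of the degrees of the two ends. *)
(* By the theorem of Borodin, Kostochka and Woodall, a bipartite graph has a    *)
(* proper edge colouring from such lists. The folded copy receives the colours  *)
(* of the central one, and the spoke joining them at v receives a colour not    *)
(* yet used at v, or its prescribed colour, which the lists at v avoid.         *)
(*                                                                              *)
(* The list colouring theorem is proved as in Galvin's argument: rank the edges *)
(* at each vertex; if every list is longer than the number of edges ranked      *)
(* before its edge at the two ends together, colour successively the stable     *)
(* matchings of the edges containing a given colour.                            *)

Require Import Defs.
From mathcomp Require Import all_boot.

Set Implicit Arguments.
Unset Strict Implicit.
Unset Printing Implicit Defensive.

(** Why the counts balance: after folding, the palette exceeds every remaining degree by at least
    one ([degree_kept]). A listed edge that meets one edge of [M] loses one colour, which this
    surplus covers. If it meets two, [spoke_isolated] shows that neither is a spoke, so both are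
    deleted edges that lower the degrees at its ends ([degree_rest_lt]), and the second loss is
    covered as well ([free_colors_enough]). The list colouring rests on [ranked_bipartite]. Its
    ranks are built by putting back one matching at a time, ranked first on one side and last on the
    other ([ranked_peel]); Hall's theorem supplies a matching for which the degrees absorb the added
    predecessors ([peelable_matching]). Then [list_coloring_of_ranks] colours by stable matchings,
    [kept_coloring] adds the prescribed edges, and [merged_extension] unfolds. *)

(** * Hall's marriage theorem *)

(** If a nonempty proper subset is tight, it and its complement, stripped of the neighbours of the
    subset, are matched separately. Otherwise all such subsets have a neighbour to spare, and one
    element may be matched arbitrarily first. *)
Lemma hall (X Y : finType) (y0 : Y) (N : X -> {set Y}) (S : {set X}) :
  (forall T : {set X}, T \subset S -> #|T| <= #|\bigcup_(x in T) N x|) ->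
  exists2 f : X -> Y, {in S &, injective f} & {in S, forall x, f x \in N x}.
Proof.
have [n leSn] := ubnP #|S|; elim: n => // n IHn in S N leSn * => hallS.
have [->|[x xS]] := set_0Vmem S.
  by exists (fun=> y0) => x; rewrite inE.
case: (boolP [exists T : {set X}, [&& T \proper S, T != set0 &
    #|\bigcup_(x in T) N x| <= #|T|]]) => [/existsP[T /and3P[ltTS T0 tight]]|noT].
  have subTS := proper_sub ltTS.
  have [||f1 inj1 f1N] := IHn T N.
  - by rewrite -ltnS; apply: leq_trans leSn; rewrite ltnS; apply: proper_card.
  - by move=> U sUT; apply: hallS; apply: subset_trans sUT subTS.
  pose N' z := N z :\: \bigcup_(x in T) N x.
  have [||f2 inj2 f2N] := IHn (S :\: T) N'.
  - rewrite -ltnS; apply: leq_trans leSn; rewrite ltnS cardsD (setIidPr subTS).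
    by rewrite ltn_subrL !card_gt0 T0; apply/set0Pn; exists x.
  - move=> U; rewrite subsetD => /andP[sUS dUT].
    (* Hall's condition for [U :|: T] descends to [U] because at most [#|T|] neighbours were
       removed. *)
    have := hallS (U :|: T); rewrite subUset sUS subTS => /(_ isT).
    rewrite cardsU; move: dUT; rewrite -setI_eq0 => /eqP->; rewrite cards0 subn0.
    move=> le1; rewrite -(leq_add2r #|T|); apply: leq_trans le1 _.
    apply: leq_trans (leq_add (leqnn _) tight).
    apply: leq_trans (leq_card_setU _ _); apply: subset_leq_card.
    apply/subsetP=> y /bigcupP[z]; rewrite !inE => /orP[zU|zT] yNz.
      case: (boolP (y \in \bigcup_(x in T) N x)) => yT; first by rewrite orbT.
      by apply/orP; left; apply/bigcupP; exists z; rewrite // inE yT.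
    by apply/orP; right; apply/bigcupP; exists z.
  exists (fun z => if z \in T then f1 z else f2 z); last first.
    move=> z zS /=; case: ifP => zT; first exact: f1N.
    by have := f2N z; rewrite !inE zT zS => /(_ isT)/andP[].
  have sep z w : z \in T -> w \in S -> w \notin T -> f1 z <> f2 w.
    move=> zT wS wT eqf; have := f2N w; rewrite !inE wT wS => /(_ isT)/andP[].
    by rewrite -eqf => /bigcupP[]; exists z; rewrite // f1N.
  move=> z w zS wS /=; case: ifP => zT; case: ifP => wT.
  - exact: inj1.
  - by move/sep; rewrite zT wT => /(_ isT wS isT).
  - by move=> /esym/sep; rewrite zT wT => /(_ isT zS isT).
  - by apply: inj2; rewrite inE ?zT ?wT.
have strict (T : {set X}) : T \proper S -> T != set0 -> #|T| < #|\bigcup_(x in T) N x|.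
  move=> ltTS T0; rewrite ltnNge; apply: contra noT => le.
  by apply/existsP; exists T; rewrite ltTS T0.
have /set0Pn[y yNx] : N x != set0.
  by have := hallS [set x]; rewrite sub1set xS cards1 big_set1 card_gt0; apply.
have [||f injf fN] := IHn (S :\ x) (fun z => N z :\ y).
- by move: leSn; rewrite (cardsD1 x) xS.
- move=> T sT; have [->|T0] := eqVneq T set0; first by rewrite cards0.
  have /strict/(_ T0) : T \proper S by apply: sub_proper_trans sT (properD1 xS).
  move=> lt1; rewrite -ltnS; apply: leq_trans lt1 _.
  have sub : \bigcup_(z in T) N z \subset y |: \bigcup_(z in T) (N z :\ y).
    apply/subsetP=> w /bigcupP[z zT wN]; rewrite !inE; case: eqVneq => //= wy.
    by apply/bigcupP; exists z; rewrite // !inE wy.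
  by apply: leq_trans (subset_leq_card sub) _; rewrite cardsU1 -add1n leq_add2r leq_b1.
have fNy z : z \in S -> z != x -> f z != y /\ f z \in N z.
  by move=> zS zx; have := fN z; rewrite !inE zx => /(_ zS)/andP[].
exists (fun z => if z == x then y else f z); last first.
  move=> z zS /=; case: eqVneq => [->//|zx].
  by case: (fNy z zS zx).
move=> z w zS wS /=; case: eqVneq => [->|zx]; case: eqVneq => [->|wx] //.
- by move=> yf; case: (fNy w wS wx); rewrite -yf eqxx.
- by move=> yf; case: (fNy z zS zx); rewrite yf eqxx.
- by apply: injf; rewrite !inE ?zx ?wx.
Qed.

(** * Stable matchings and Galvin's list colouring *)

(** Edges are abstract indices with one end on each side, given by [a] and [b]; parallel edges are
    allowed. *)
Definition matching (I X Y : finType) (a : I -> X) (b : I -> Y) (N : {set I}) :=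
  {in N &, injective a} /\ {in N &, injective b}.

Definition untied (I X : finType) (a : I -> X) (r : I -> nat) (E : {set I}) :=
  {in E &, forall e f, a e = a f -> r e = r f -> e = f}.

Definition better (I X : finType) (a : I -> X) (r : I -> nat) (E : {set I}) e :=
  [set f in E | (a f == a e) && (r f < r e)].

Definition degree (I X : finType) (a : I -> X) (E : {set I}) x :=
  #|[set f in E | a f == x]|.

Lemma untiedS (I X : finType) (a : I -> X) r (E F : {set I}) :
  F \subset E -> untied a r E -> untied a r F.
Proof. by move=> /subsetP sFE unt e f /sFE eE /sFE fE; apply: unt. Qed.

Lemma betterS (I X : finType) (a : I -> X) r (E F : {set I}) e :
  F \subset E -> better a r F e \subset better a r E e.
Proof.
move=> /subsetP sFE; apply/subsetP=> f.
by rewrite !inE => /and3P[/sFE-> -> ->].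
Qed.

Lemma stable_matching (I X Y : finType) (a : I -> X) (b : I -> Y)
    (ra rb : I -> nat) (F : {set I}) :
  untied a ra F -> untied b rb F ->
  exists N : {set I}, [/\ N \subset F, matching a b N &
    forall e, e \in F -> e \notin N ->
      exists2 f, f \in N & f \in better a ra F e :|: better b rb F e].
Proof.
have [n leFn] := ubnP #|F|; elim: n => // n IHn in F leFn * => unta untb.
pose top := [set e in F | better a ra F e == set0].
have topF : top \subset F by apply/subsetP=> e; rewrite inE => /andP[].
have topP e f : e \in top -> f \in F -> a f = a e -> ra e <= ra f.
  rewrite inE => /andP[_ /eqP/setP/(_ f)]; rewrite !inE => nb fF afe.
  by move/negbT: nb; rewrite fF afe eqxx /= -leqNgt.
case: (boolP [exists e in top, [exists e' in top, (b e == b e') && (rb e < rb e')]]).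
  case/exists_inP=> e etop /exists_inP[e' e'top /andP[/eqP bee' ltee']].
  have eF := subsetP topF _ etop; have e'F := subsetP topF _ e'top.
  have sF := subD1set F e'.
  have [|||N [sNF mN dom]] := IHn (F :\ e').
  - by move: leFn; rewrite (cardsD1 e') e'F.
  - exact: untiedS unta.
  - exact: untiedS untb.
  exists N; split=> //; first exact: subset_trans sF.
  have up f g : f \in better a ra (F :\ e') g :|: better b rb (F :\ e') g ->
      f \in better a ra F g :|: better b rb F g.
    by apply: subsetP; apply: setUSS; apply: betterS.
  move=> g gF gN; have [ge'|ge'] := eqVneq g e'; last first.
    by have [|f fN /up] := dom g _ gN; [rewrite !inE ge' | exists f].
  have [eN|eN] := boolP (e \in N).
    by exists e; rewrite // ge' !inE eF bee' eqxx ltee' orbT.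
  have [|f fN] := dom e _ eN.
    by rewrite !inE eF andbT; apply: contraTneq ltee' => ->; rewrite ltnn.
  rewrite !inE => /orP[/and3P[/andP[_ fF] /eqP afe]|/and3P[/andP[_ fF] /eqP bfe ltfe]].
    by rewrite ltnNge topP.
  by exists f; rewrite // ge' !inE fF bfe bee' eqxx (ltn_trans ltfe ltee') orbT.
move=> notop; exists top; split=> //.
  split=> e f etop ftop.
    have eF := subsetP topF _ etop; have fF := subsetP topF _ ftop.
    by move=> aef; apply: unta => //; apply/eqP; rewrite eqn_leq !topP.
  have eF := subsetP topF _ etop; have fF := subsetP topF _ ftop.
  move=> bef; apply: untb => //; apply/eqP; rewrite eqn_leq (leqNgt (rb e)) (leqNgt (rb f)).
  apply/andP; split; apply: contra notop => lt.
    by apply/exists_inP; exists f => //; apply/exists_inP; exists e; rewrite // bef eqxx.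
  by apply/exists_inP; exists e => //; apply/exists_inP; exists f; rewrite // bef eqxx.
move=> e eF etop.
have [|f /andP[fF /eqP afe] fmin] := @arg_minnP _ e [pred f in F | a f == a e] ra.
  by rewrite /= eF eqxx.
have ftop : f \in top.
  rewrite inE fF; apply/eqP/setP=> g; rewrite !inE; apply/negP=> /and3P[gF /eqP agf].
  by apply/negP; rewrite -leqNgt; apply: fmin; rewrite /= gF agf afe eqxx.
exists f => //; rewrite !inE fF afe eqxx /= ltn_neqAle; apply/orP; left.
rewrite fmin ?inE /= ?eF ?eqxx // andbT; apply: contraNneq etop => /unta <- //.
Qed.

Definition proper_on (I X Y C : finType) (a : I -> X) (b : I -> Y) (E : {set I})
    (c : I -> C) :=
  {in E &, forall e f, a e = a f \/ b e = b f -> c e = c f -> e = f}.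

(** A stable matching of the edges whose lists contain [j] receives [j]. Every other edge that loses
    [j] also loses a predecessor lying in the matching, so the strict inequality survives. *)
Lemma list_coloring_of_ranks (I X Y C : finType) (a : I -> X) (b : I -> Y)
    (ra rb : I -> nat) (c0 : C) (E : {set I}) (L : I -> {set C}) :
  untied a ra E -> untied b rb E ->
  {in E, forall e, #|better a ra E e| + #|better b rb E e| < #|L e|} ->
  exists2 c : I -> C, {in E, forall e, c e \in L e} & proper_on a b E c.
Proof.
have [n leEn] := ubnP #|E|; elim: n => // n IHn in E L leEn * => unta untb ltL.
have [->|[e0 e0E]] := set_0Vmem E.
  by exists (fun=> c0) => e; rewrite inE.
have /card_gt0P[j jL] : 0 < #|L e0| by apply: leq_ltn_trans (ltL _ e0E).
pose F := [set e in E | j \in L e].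
have sFE : F \subset E by apply/subsetP=> e; rewrite inE => /andP[].
have [N [sNF [injaN injbN] dom]] :=
  stable_matching (untiedS sFE unta) (untiedS sFE untb).
have sNE := subset_trans sNF sFE.
(* A nonempty [N] makes the induction on [#|E|] progress. *)
have [f0 f0N] : exists f, f \in N.
  have [|/dom[|f fN _]] := boolP (e0 \in N); first by exists e0.
    by rewrite inE e0E.
  by exists f.
have sDE : E :\: N \subset E by apply: subsetDl.
have [||||c cL cprop] := IHn (E :\: N) (fun e => L e :\ j).
- rewrite -ltnS; apply: leq_trans leEn; rewrite ltnS; apply: proper_card.
  by apply/properP; split=> //; exists f0; rewrite ?inE ?f0N // (subsetP sNE).
- exact: untiedS unta.
- exact: untiedS untb.
- move=> e; rewrite inE => /andP[eN eE].
  have sa := betterS a ra e sDE; have sb := betterS b rb e sDE.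
  have [jLe|jLe] := boolP (j \in L e); last first.
    have -> : L e :\ j = L e by apply/setDidPl; rewrite disjoint_sym disjoints1.
    by apply: leq_ltn_trans (ltL _ eE); rewrite leq_add // subset_leq_card.
  have := ltL _ eE; rewrite (cardsD1 j) jLe add1n ltnS; apply: leq_trans.
  have [|f fN] := dom e _ eN; first by rewrite inE eE.
  rewrite inE => /orP[fb|fb].
    rewrite -addSn leq_add ?subset_leq_card //; apply: proper_card.
    apply/properP; split=> //; exists f; last by rewrite !inE fN.
    exact: subsetP (betterS _ _ _ sFE) _ fb.
  rewrite -addnS leq_add ?subset_leq_card //; apply: proper_card.
  apply/properP; split=> //; exists f; last by rewrite !inE fN.
  exact: subsetP (betterS _ _ _ sFE) _ fb.
have cN e : e \in E -> e \notin N -> c e != j /\ c e \in L e.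
  by move=> eE eN; have := cL e; rewrite !inE eN => /(_ eE)/andP[].
exists (fun e => if e \in N then j else c e).
  move=> e eE /=; case: ifPn => [|/cN[]//].
  by move=> /(subsetP sNF); rewrite inE => /andP[].
move=> e f eE fE adj /=; case: ifPn => eN; case: ifPn => fN.
- by move=> _; case: adj; [apply: injaN | apply: injbN].
- by move=> jc; case: (cN f fE fN); rewrite -jc eqxx.
- by move=> jc; case: (cN e eE eN); rewrite jc eqxx.
- by apply: cprop => //; rewrite inE ?eN ?fN.
Qed.

(** * Ranks bounded by the larger end degree (Borodin, Kostochka, Woodall) *)

Definition ranked (I X Y : finType) (a : I -> X) (b : I -> Y) (E : {set I}) :=
  exists ra rb : I -> nat, [/\ untied a ra E, untied b rb E &
    {in E, forall e, #|better a ra E e| + #|better b rb E e| <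
                     maxn (degree a E (a e)) (degree b E (b e))}].

Lemma ranked_sym (I X Y : finType) (a : I -> X) (b : I -> Y) (E : {set I}) :
  ranked a b E -> ranked b a E.
Proof.
move=> [ra [rb [ua ub lt]]]; exists rb, ra; split=> // e eE.
by rewrite addnC maxnC lt.
Qed.

(** For a matching [K] inside [E] this says: once [K] is removed, an edge whose a-end was covered
    has a-degree at least its b-degree. *)
Definition peelable (I X Y : finType) (a : I -> X) (b : I -> Y) (E K : {set I}) :=
  {in E, forall e, a e \in a @: K ->
    degree b E (b e) < degree a E (a e) + (b e \in b @: K)}.

Lemma degreeD (I X : finType) (a : I -> X) (E K : {set I}) x :
  K \subset E -> {in K &, injective a} ->
  degree a E x = degree a (E :\: K) x + (x \in a @: K).
Proof.
move=> sKE injK; rewrite /degree -(cardsID K) addnC; congr (_ + _).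
  by apply: eq_card => f; rewrite !inE andbA.
case: imsetP => [[k kK ->]|xK].
  rewrite (_ : _ :&: _ = [set k]) ?cards1 //; apply/setP=> f; rewrite !inE.
  apply/idP/eqP=> [/andP[/andP[_ /eqP afk] fK]|->]; first exact: injK.
  by rewrite (subsetP sKE) // eqxx.
rewrite (_ : _ :&: _ = set0) ?cards0 //; apply/setP=> f; rewrite !inE.
by apply/negP=> /andP[/andP[_ /eqP afx] fK]; apply: xK; exists f.
Qed.

(* [K] is ranked first at its a-ends and last at its b-ends. *)
Lemma ranked_peel (I X Y : finType) (a : I -> X) (b : I -> Y) (E K : {set I}) :
  K \subset E -> matching a b K -> peelable a b E K ->
  ranked a b (E :\: K) -> ranked a b E.
Proof.
move=> sKE [injaK injbK] peel [ra [rb [ua ub lt]]].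
pose M := \max_(e in E) rb e.
have rbM e : e \in E -> rb e <= M by move=> eE; apply: (@leq_bigmax_cond _ (mem E) rb).
pose ra' e := if e \in K then 0 else (ra e).+1.
pose rb' e := if e \in K then M.+1 else rb e.
exists ra', rb'; split.
- move=> e f eE fE aef; rewrite /ra'; case: ifPn => eK; case: ifPn => fK // .
    by move=> _; apply: injaK.
  by case; apply: ua; rewrite // inE ?eK ?fK.
- move=> e f eE fE bef; rewrite /rb'; case: ifPn => eK; case: ifPn => fK.
  + by move=> _; apply: injbK.
  + by move=> eqM; have := rbM f fE; rewrite -eqM ltnn.
  + by move=> eqM; have := rbM e eE; rewrite eqM ltnn.
  + by apply: ub; rewrite // inE ?eK ?fK.
move=> e eE; case: (boolP (e \in K)) => eK.
  rewrite (_ : better a ra' E e = set0); last first.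
    by apply/setP=> f; rewrite !inE /ra' eK ltn0 !andbF.
  rewrite cards0 add0n leq_max; apply/orP; right.
  apply: proper_card; apply/properP; split.
    by apply/subsetP=> f; rewrite !inE => /and3P[-> ->].
  by exists e; rewrite !inE eE eqxx // ltnn.
have eEK : e \in E :\: K by rewrite inE eK.
have -> : better b rb' E e = better b rb (E :\: K) e.
  apply/setP=> f; rewrite !inE /rb' (negPf eK); case: ifPn => // fK.
  by rewrite ltnNge ltnW ?ltnS ?rbM ?andbF.
have le_a : #|better a ra' E e| <= (a e \in a @: K) + #|better a ra (E :\: K) e|.
  have sub : better a ra' E e \subset
      [set f in K | a f == a e] :|: better a ra (E :\: K) e.
    apply/subsetP=> f; rewrite !inE /ra' (negPf eK); case: ifPn => fK /=.
      by case/and3P=> _ -> _.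
    by rewrite ltnS.
  apply: leq_trans (subset_leq_card sub) _.
  rewrite cardsU; apply: leq_trans (leq_subr _ _) _; rewrite leq_add2r.
  have := degreeD (a e) (subxx K) injaK; rewrite /degree => ->.
  by rewrite setDv (_ : [set _ in _ | _] = set0) ?cards0 //; apply/setP=> f; rewrite !inE.
have := lt e eEK; rewrite (degreeD (a e) sKE injaK) (degreeD (b e) sKE injbK).
set da := degree a _ _; set db := degree b _ _ => lte.
have := peel e eE; rewrite (degreeD (a e) sKE injaK) (degreeD (b e) sKE injbK).
(* If [K] covers the a-end, at most one predecessor is added; since [db <= da], the larger degree
   also grows by one. Otherwise no predecessor is added. *)
rewrite -/da -/db; move: le_a; case: (a e \in _) => /= [le_a /(_ isT) lt_ab|le_a _].
  rewrite ltn_add2r addn1 ltnS in lt_ab.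
  apply: (@leq_trans (maxn da db).+1); last first.
    rewrite leq_max; apply/orP; left; rewrite addn1 ltnS.
    by rewrite geq_max leqnn.
  by rewrite ltnS; apply: leq_trans lte; rewrite -add1n addnA leq_add2r.
apply: leq_trans (_ : maxn da db <= _); last first.
  by rewrite geq_max !leq_max addn0 leqnn leq_addr orbT.
by apply: leq_ltn_trans lte; rewrite leq_add2r.
Qed.

(** Converts the partners chosen by Hall's theorem into actual edges. *)
Lemma matching_of_sdr (I X Y : finType) (a : I -> X) (b : I -> Y) (E : {set I})
    (S : {set X}) (f : X -> Y) :
  {in S &, injective f} ->
  {in S, forall x, exists2 e, e \in E & a e = x /\ b e = f x} ->
  exists K : {set I}, [/\ K \subset E, matching a b K, a @: K = S & b @: K = f @: S].
Proof.
move=> injf ef; have [->|[x0 x0S]] := set_0Vmem S.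
  exists set0; rewrite sub0set !imset0; split=> //.
  by split=> e f'; rewrite inE.
have [e0 _ _] := ef x0 x0S.
pose g x := odflt e0 [pick e in E | (a e == x) && (b e == f x)].
have gP x : x \in S -> [/\ g x \in E, a (g x) = x & b (g x) = f x].
  move=> /ef[e eE [ae be]]; rewrite /g; case: pickP => [e' /and3P[e'E /eqP-> /eqP->] //|].
  by move/(_ e); rewrite eE ae be !eqxx.
exists (g @: S); split.
- by apply/subsetP=> _ /imsetP[x xS ->]; case: (gP x xS).
- split=> _ _ /imsetP[x xS ->] /imsetP[y yS ->];
    have [_ ax bx] := gP x xS; have [_ ay by_] := gP y yS.
    by rewrite ax ay => ->.
  by rewrite bx by_ => /injf->.
- rewrite -imset_comp -[RHS]imset_id; apply: eq_in_imset => x xS /=.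
  by case: (gP x xS).
- rewrite -imset_comp; apply: eq_in_imset => x xS /=.
  by case: (gP x xS).
Qed.

(* Among the ends of maximum degree D, either some nonempty minimal set of      *)
(* a-ends with at most as many neighbours is matched onto its neighbourhood, or *)
(* Hall's theorem matches all a-ends of degree D into b-ends of degree D.       *)
Lemma peelable_matching (I X Y : finType) (a : I -> X) (b : I -> Y) (E : {set I}) :
  E != set0 -> exists K : {set I}, [/\ K != set0, K \subset E, matching a b K &
    peelable a b E K \/ peelable b a E K].
Proof.
move=> /set0Pn[e0 e0E].
pose d e := maxn (degree a E (a e)) (degree b E (b e)).
have [e1 e1E dmax] : exists2 e, e \in E & forall f, f \in E -> d f <= d e.
  by have [e eE emax] := @arg_maxnP _ e0 (mem E) d e0E; exists e.
set D := d e1 in dmax.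
have daD e : e \in E -> degree a E (a e) <= D.
  by move=> /dmax; apply: leq_trans; apply: leq_maxl.
have dbD e : e \in E -> degree b E (b e) <= D.
  by move=> /dmax; apply: leq_trans; apply: leq_maxr.
have D_gt0 : 0 < D.
  by apply: leq_trans (daD e1 e1E); apply/card_gt0P; exists e1; rewrite inE e1E eqxx.
pose XD := [set x | degree a E x == D]; pose YD := [set y | degree b E y == D].
have aXD e : e \in E -> a e \notin XD -> degree a E (a e) < D.
  by move=> eE; rewrite inE ltn_neqAle => ->; apply: daD.
have bYD e : e \in E -> b e \notin YD -> degree b E (b e) < D.
  by move=> eE; rewrite inE ltn_neqAle => ->; apply: dbD.
have matching1 e : matching a b [set e].
  by split=> f g /set1P-> /set1P->.
have nbr x : x \in XD -> exists2 e, e \in E & a e = x.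
  rewrite inE => /eqP dx; have /card_gt0P[e] : 0 < degree a E x by rewrite dx.
  by rewrite inE => /andP[eE /eqP]; exists e.
(* Only neighbours of full degree [D] matter: an edge from an a-end of degree [D] to a b-end of
   smaller degree satisfies the peeling inequality anyway. *)
pose N x := [set y in YD | [exists e in E, (a e == x) && (b e == y)]].
have NP e : e \in E -> b e \in YD -> b e \in N (a e).
  by move=> eE eY; rewrite inE eY; apply/exists_inP; exists e; rewrite ?eqxx.
have sdrN (S : {set X}) f : {in S &, injective f} -> {in S, forall x, f x \in N x} ->
    exists K : {set I}, [/\ K \subset E, matching a b K, a @: K = S & b @: K = f @: S].
  move=> injf fN; apply: matching_of_sdr => // x /fN; rewrite inE => /andP[_].
  by case/exists_inP=> e eE /andP[/eqP ae /eqP be]; exists e.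
(* If all neighbours of [x] have degree below [D], a single edge at [x] is peelable. *)
case: (boolP [exists x in XD, N x == set0]) => [/exists_inP[x xXD /eqP Nx0]|allN].
  have [e eE ae] := nbr x xXD.
  exists [set e]; split=> //; rewrite ?sub1set //.
    by apply/set0Pn; exists e; rewrite inE.
  left=> f fE; rewrite imset_set1 inE ae => /eqP af; apply: ltn_addr.
  move: xXD; rewrite af inE => /eqP->; apply: bYD => //; apply/negP=> /(NP f fE).
  by rewrite af Nx0 inE.
pose small (T : {set X}) := [&& T \subset XD, T != set0 & #|\bigcup_(x in T) N x| <= #|T|].
case: (boolP [exists T, small T]) => [/existsP/ex_minset[T /minsetP[Tsmall minT]]|nosmall].
  have /and3P[sTX T0 leT] := Tsmall.
  have Nle (T' T'' : {set X}) : T' \subset T'' ->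
      #|\bigcup_(x in T') N x| <= #|\bigcup_(x in T'') N x|.
    move=> /subsetP sT; apply: subset_leq_card; apply/bigcupsP=> x /sT xT.
    exact: bigcup_sup.
  (* With fewer neighbours, [T] minus a vertex would be a smaller such set, or [T] would be a
     singleton without neighbours in [YD], against [allN]. *)
  have eqT : #|\bigcup_(x in T) N x| = #|T|.
    apply/eqP; rewrite eqn_leq leT /= leqNgt; apply/negP=> ltT.
    have /set0Pn[x xT] := T0.
    have [Tx0|Tx0] := eqVneq (T :\ x) set0.
      move: allN; rewrite negb_exists_in => /forall_inP/(_ x (subsetP sTX x xT))/negP[].
      have sub : N x \subset \bigcup_(z in T) N z by apply: bigcup_sup.
      rewrite -cards_eq0 -leqn0; apply: leq_trans (subset_leq_card sub) _.
      by move: ltT; rewrite [X in _ < X](cardsD1 x) xT Tx0 cards0.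
    have : T :\ x = T.
      apply: minT (subD1set _ _); rewrite /small Tx0 (subset_trans (subD1set _ _) sTX) /=.
      apply: leq_trans (Nle _ _ (subD1set T x)) _.
      by move: ltT; rewrite [X in _ < X](cardsD1 x) xT.
    by move/setP/(_ x); rewrite !inE eqxx xT.
  have [U sUT|f injf fN] := @hall _ _ (b e0) N T.
    have [->|U0] := eqVneq U set0; first by rewrite cards0.
    have [->|UT] := eqVneq U T; first by rewrite eqT.
    rewrite leqNgt; apply: contra_neqN UT => ltU; apply: minT => //.
    by rewrite /small U0 (subset_trans sUT) // ltnW.
  have [K [sKE mK aK bK]] := sdrN T f injf fN.
  exists K; split=> //; first by rewrite -(imset_eq0 a) aK.
  have bKN : b @: K = \bigcup_(x in T) N x.
    apply/eqP; rewrite eqEcard bK eqT card_in_imset // leqnn andbT.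
    by apply/subsetP=> _ /imsetP[x xT ->]; apply/bigcupP; exists x; rewrite // fN.
  left=> e eE; rewrite aK bKN => aeT.
  have := subsetP sTX _ aeT; rewrite inE => /eqP->.
  have [eY|/(bYD e eE)] := boolP (b e \in YD); last exact: ltn_addr.
  rewrite (_ : (b e \in _) = true) ?addn1 ?ltnS ?dbD //.
  by apply/bigcupP; exists (a e); rewrite // NP.
have bpeel (K : {set I}) : XD \subset a @: K -> b @: K \subset YD -> peelable b a E K.
  move=> /subsetP sXK /subsetP sKY e eE /sKY; rewrite inE => /eqP->.
  have [/sXK->|/(aXD e eE)] := boolP (a e \in XD); last exact: ltn_addr.
  by rewrite addn1 ltnS daD.
(* If no a-end has degree [D], the b-end of [e1] does, and [e1] alone is peelable from the
   b-side. *)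
have [XD0|[x0 x0X]] := set_0Vmem XD.
  exists [set e1]; split; rewrite ?sub1set //.
    by apply/set0Pn; exists e1; rewrite inE.
  right; apply: bpeel; first by rewrite XD0 sub0set.
  rewrite imset_set1 sub1set inE eqn_leq dbD // /D /d geq_max leqnn andbT.
  rewrite leqNgt; apply/negP=> lt_ba; have : a e1 \in XD; last by rewrite XD0 inE.
  by rewrite inE /D /d (maxn_idPl (ltnW lt_ba)).
have [U sUX|f injf fN] := @hall _ _ (b e0) N XD.
  have [->|U0] := eqVneq U set0; first by rewrite cards0.
  rewrite leqNgt; apply: contra nosmall => ltU; apply/existsP; exists U.
  by rewrite /small sUX U0 ltnW.
have [K [sKE mK aK bK]] := sdrN XD f injf fN.
exists K; split=> //; first by rewrite -(imset_eq0 a) aK; apply/set0Pn; exists x0.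
right; apply: bpeel; first by rewrite aK.
by rewrite bK; apply/subsetP=> _ /imsetP[x /fN xN ->]; move: xN; rewrite inE => /andP[].
Qed.

(** Matchings are peeled until no edge is left; the side whose ends are ranked first may change at
    each round. *)
Lemma ranked_bipartite (I X Y : finType) (a : I -> X) (b : I -> Y) (E : {set I}) :
  ranked a b E.
Proof.
have [n leEn] := ubnP #|E|; elim: n => // n IHn in E leEn *.
have [->|E0] := eqVneq E set0.
  by exists (fun=> 0), (fun=> 0); split=> e; rewrite inE.
have [K [K0 sKE mK peel]] := peelable_matching a b E0.
have rEK : ranked a b (E :\: K).
  apply: IHn; rewrite -ltnS; apply: leq_trans leEn; rewrite ltnS.
  have /set0Pn[k kK] := K0; apply: proper_card; apply/properP.
  by split; [apply: subsetDl | exists k; rewrite ?inE ?kK // (subsetP sKE)].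
case: peel => peel; first exact: ranked_peel rEK.
apply: ranked_sym; apply: (ranked_peel sKE _ peel); last exact: ranked_sym.
by case: mK.
Qed.

(** Each list is measured against the degrees at its own edge, not the maximum degree; the shorter
    lists between two edges of [M] require this. *)
Lemma bipartite_list_edge_coloring (I X Y C : finType) (a : I -> X) (b : I -> Y)
    (c0 : C) (E : {set I}) (L : I -> {set C}) :
  {in E, forall e, maxn (degree a E (a e)) (degree b E (b e)) <= #|L e|} ->
  exists2 c : I -> C, {in E, forall e, c e \in L e} & proper_on a b E c.
Proof.
move=> leL; have [ra [rb [ua ub lt]]] := ranked_bipartite a b E.
apply: (list_coloring_of_ranks c0 ua ub) => e eE.
exact: leq_trans (lt e eE) (leL e eE).
Qed.

(** * Distance between edges *)

Lemma edge_dist_gt1 (T : finType) (e : rel T) (f g : {set T}) x z :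
  1 < edge_dist e f g -> x \in f -> z \in g -> x != z /\ ~~ e x z.
Proof.
have minn_le (F : T -> nat) (A : {set T}) y :
    y \in A -> \big[minn/#|T|]_(w in A) F w <= F y.
  move=> yA; have : y \in [seq w <- index_enum T | w \in A].
    by rewrite mem_filter yA mem_index_enum.
  rewrite -big_filter; elim: [seq _ <- _ | _] => //= w s IHs.
  rewrite inE big_cons => /orP[/eqP<-|/IHs]; first exact: geq_minl.
  by apply: leq_trans; apply: geq_minr.
move=> gt1 xf zg; have {}gt1 : 1 < dist e x z.
  apply: leq_trans gt1 _; apply: leq_trans (minn_le _ _ _ xf) _.
  exact: minn_le zg.
(* [find] never exceeds the length of its list, so [dist] tests both lengths 0 and 1. *)
have szT : 1 < #|T|.
  by apply: leq_trans gt1 _; rewrite -[X in _ <= X](size_iota 0) find_size.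
split; apply/negP.
  have := before_find 0 (ltnW gt1); rewrite nth_iota ?(ltnW szT) // => + /eqP xz.
  move/negbT/existsP; apply; exists [tuple]; rewrite /= xz eqxx //.
have := before_find 0 gt1; rewrite nth_iota // => + exz.
by move/negbT/existsP; apply; exists [tuple z]; rewrite /= exz eqxx.
Qed.

(** * Folding one leaf copy onto the central copy *)

Section MergedLeaf.

Variables (V : finType) (e : rel V) (m : nat) (A : {set V}).
Hypotheses (e_sym : symmetric e) (e_irr : irreflexive e).
Hypothesis e_bip : forall x y, e x y -> (x \in A) != (y \in A).

Local Notation T := (V * option 'I_m.+1)%type.
Local Notation H := (cartesian_product e (star m.+1)).
Local Notation leaf0 := (Some (ord0 : 'I_m.+1)).

Lemma edgeC x y : H x y = H y x.
Proof.
by rewrite /cartesian_product /star e_sym (eq_sym x.1) (eq_sym x.2) (eq_sym (x.2 == None)).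
Qed.

(** The bipartition of the product: each kind of edge flips exactly one of the two summands. *)
Definition side (x : T) := (x.1 \in A) (+) (x.2 == None).

Lemma edge_side x y : H x y -> side x != side y.
Proof.
rewrite /side /cartesian_product /star => /orP[/andP[/eqP-> ne]|/andP[/eqP-> /e_bip ne]].
  by move: ne; do 2!case: (_ == None); case: (_ \in A).
by move: ne; do 2!case: (_ \in A); case: (_ == None).
Qed.

Lemma edge_neq x y : H x y -> x != y.
Proof. by move/edge_side; apply: contraNneq => ->. Qed.

Lemma edge_setP (f : {set T}) :
  reflect (exists x y, [/\ H x y, f = [set x; y], side x & ~~ side y]) (f \in edge_set H).
Proof.
apply: (iffP imsetP) => [[[x y]]|[x [y [Hxy -> _ _]]]]; last first.
  by exists (x, y); rewrite ?inE.
rewrite inE /= => Hxy ->; have := edge_side Hxy.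
case sx: (side x); case sy: (side y) => // _; first by exists x, y; rewrite sx sy.
by exists y, x; rewrite sx sy edgeC setUC.
Qed.

(* Leaf copy number 0 is folded onto the copy of the centre. *)
Definition fold (x : T) : T := if x.2 == leaf0 then (x.1, None) else x.

Definition spoke (v : V) : {set T} := [set (v, None); (v, leaf0)].

Definition kept_edges : {set {set T}} :=
  [set f in edge_set H | [forall x in f, x.2 != leaf0]].

(** Only the two ends of a spoke are identified, and they are adjacent; hence separated edges of [M]
    keep disjoint images. *)
Lemma fold_inj x y : fold x = fold y -> x = y \/ H x y.
Proof.
case: x y => [u o] [w o']; rewrite /fold /=.
case: eqVneq => [->|_]; case: eqVneq => [->|_] [] -> //; try by left.
  by move=> <-; right; rewrite /cartesian_product /star /= eqxx.
  by move=> ->; right; rewrite /cartesian_product /star /= eqxx.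
by move=> ->; left.
Qed.

Lemma fold_edge f : f \in edge_set H ->
  (exists v, f = spoke v) \/ fold @: f \in kept_edges.
Proof.
move=> /edge_setP[x [y [Hxy -> _ _]]].
have [[v eqv]|Hf] : (exists v, [set x; y] = spoke v) \/ H (fold x) (fold y).
- move: Hxy; case: x y => [u o] [w o']; rewrite /fold /=.
  case: (eqVneq o leaf0) => [->|o0]; case: (eqVneq o' leaf0) => [->|o'0];
    rewrite /cartesian_product /star /=.
  + by rewrite andbF /= => euw; right; rewrite euw ?orbT.
  + case: o' o'0 => [j|] j0 /=; rewrite ?andbF ?andbT ?orbF.
      by move=> /orP[//|/andP[/eqP eqj _]]; rewrite -eqj eqxx in j0.
    by move=> /eqP->; left; exists w; rewrite /spoke setUC.
  + case: o o0 => [j|] j0 /=; rewrite ?andbF ?andbT ?orbF.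
      by move=> /orP[//|/andP[/eqP eqj _]]; rewrite eqj eqxx in j0.
    by move=> /eqP->; left; exists w; rewrite /spoke.
  + by right.
- by left; exists v.
right; rewrite imsetU1 imset_set1 inE; apply/andP; split.
  by apply/imsetP; exists (fold x, fold y); rewrite ?inE.
have fold0 z : (fold z).2 != leaf0 by rewrite /fold; case: ifPn.
by apply/forall_inP=> z; rewrite !inE => /orP[] /eqP->.
Qed.

Lemma kept_edgeP f : f \in kept_edges -> exists x y,
  [/\ H x y, f = [set x; y], side x, ~~ side y & x.2 != leaf0 /\ y.2 != leaf0].
Proof.
rewrite inE => /andP[/edge_setP[x [y [Hxy -> sx sy]]] /forall_inP keep].
by exists x, y; split=> //; split; apply: keep; rewrite !inE eqxx ?orbT.
Qed.

Lemma degree_kept x : #|[set f in kept_edges | x \in f]| <= max_degree e + m.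
Proof.
have [x0|x0] := eqVneq x.2 leaf0.
  rewrite (_ : [set _ in _ | _] = set0) ?cards0 //; apply/setP=> f; rewrite !inE.
  by apply/negP=> /andP[/andP[_ /forall_inP keep] /keep]; rewrite x0 eqxx.
pose N := [set y | H x y && (y.2 != leaf0)].
have sub : [set f in kept_edges | x \in f] \subset [set [set x; y] | y in N].
  apply/subsetP=> f; rewrite inE => /andP[/kept_edgeP[y [z [Hyz -> _ _ [y0 z0]]]]].
  rewrite !inE => /orP[] /eqP eqx; apply/imsetP.
    by exists z; rewrite ?inE eqx ?Hyz.
  by exists y; rewrite ?inE eqx 1?edgeC ?Hyz // setUC.
apply: leq_trans (subset_leq_card sub) _; apply: leq_trans (leq_imset_card _ _) _.
have subN : N \subset [set (u, x.2) | u in [set u | e x.1 u]] :|: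
    [set (x.1, o) | o in [set o | star m.+1 x.2 o && (o != leaf0)]].
  apply/subsetP=> -[u o]; rewrite !inE /cartesian_product /=.
  case/andP=> /orP[/andP[/eqP<- so]|/andP[/eqP<- eu]] o0.
    by apply/orP; right; apply/imsetP; exists o; rewrite ?inE ?so.
  by apply/orP; left; apply/imsetP; exists u; rewrite ?inE.
apply: leq_trans (subset_leq_card subN) _; apply: leq_trans (leq_card_setU _ _) _.
apply: leq_add; apply: leq_trans (leq_imset_card _ _) _.
  exact: (leq_bigmax (F := fun v => #|[set u | e v u]|)).
case: {+}x.2 x0 => [j|] j0.
  apply: (@leq_trans #|[set (None : option 'I_m.+1)]|).
    by apply: subset_leq_card; apply/subsetP=> -[i|]; rewrite !inE /star //.
  (* A leaf other than [leaf0] exists, so [m] is positive and allows for its one edge to the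
     centre. *)
  rewrite cards1 lt0n; apply: contra_neqN j0 => /eqP m0.
  by congr Some; apply: val_inj; apply/eqP; rewrite /= -leqn0 -[X in _ <= X]m0 -ltnS.
apply: (@leq_trans #|[set Some i | i in [set~ (ord0 : 'I_m.+1)]]|).
  apply: subset_leq_card; apply/subsetP=> -[i|]; rewrite !inE /star //= => i0.
  by apply/imsetP; exists i; rewrite // !inE; apply: contraNneq i0 => ->.
by apply: leq_trans (leq_imset_card _ _) _; rewrite cardsC1 card_ord.
Qed.

(** * Lists for the folded graph and extension of the precolouring *)

Section Extension.

Variables (M : {set {set T}}) (phi : {set T} -> 'I_(max_degree e + m).+1).
Hypothesis MH : M \subset edge_set H.
Hypothesis Msep : forall f g x z,
  f \in M -> g \in M -> x \in f -> z \in g -> x = z \/ H x z -> f = g.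

Let aend (f : {set T}) := [pick x in f | side x].
Let bend (f : {set T}) := [pick x in f | ~~ side x].

Lemma aendP f x : f \in edge_set H -> x \in f -> side x -> aend f = Some x.
Proof.
move=> /edge_setP[y [z [_ -> sy sz]]] xf sx.
have onlyy w : w \in [set y; z] -> side w -> w = y.
  by rewrite !inE => /orP[] /eqP-> //; rewrite (negPf sz).
rewrite /aend; case: pickP => [w /andP[wf sw]|/(_ x)]; last by rewrite xf sx.
by rewrite (onlyy w) // (onlyy x).
Qed.

Lemma bendP f x : f \in edge_set H -> x \in f -> ~~ side x -> bend f = Some x.
Proof.
move=> /edge_setP[y [z [_ -> sy sz]]] xf sx.
have onlyz w : w \in [set y; z] -> ~~ side w -> w = z.
  by rewrite !inE => /orP[] /eqP-> //; rewrite sy.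
rewrite /bend; case: pickP => [w /andP[wf sw]|/(_ x)]; last by rewrite xf sx.
by rewrite (onlyz w) // (onlyz x).
Qed.

Lemma kept_sub : kept_edges \subset edge_set H.
Proof. by apply/subsetP=> f; rewrite inE => /andP[]. Qed.

Lemma meetP (f g : {set T}) :
  reflect (exists2 x, x \in f & x \in g) (~~ [disjoint f & g]).
Proof.
rewrite -setI_eq0; apply: (iffP (set0Pn _)) => [[x]|[x xf xg]].
  by rewrite inE => /andP[]; exists x.
by exists x; rewrite inE xf.
Qed.

Lemma fold_uniq f g x : f \in M -> g \in M ->
  x \in fold @: f -> x \in fold @: g -> f = g.
Proof.
move=> fM gM /imsetP[y yf ->] /imsetP[z zg /fold_inj eqyz].
exact: Msep fM gM yf zg eqyz.
Qed.

Lemma fold_spoke v : fold @: spoke v = [set (v, None)].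
Proof. by rewrite imsetU1 imset_set1 setUid. Qed.

Lemma spoke_mem v x : x \in spoke v -> x.1 = v.
Proof. by rewrite !inE => /orP[] /eqP->. Qed.

(** A preimage of [y] in [g] would be adjacent to an end of the spoke, so [g] would be the spoke
    itself, whose image is the single vertex [x]. *)
Lemma spoke_isolated v g x y : spoke v \in M -> g \in M -> H x y -> y.2 != leaf0 ->
  x \in fold @: spoke v -> y \notin fold @: g.
Proof.
move=> vM gM Hxy y0; rewrite fold_spoke => /set1P eqx; rewrite {x}eqx in Hxy.
apply/negP=> /imsetP[z zg]; rewrite /fold; case: eqVneq => [z0 eqy|_ eqy].
  have evz : e v z.1.
    by move: Hxy; rewrite eqy /cartesian_product /star /= andbF.
  have Hvz : H (v, leaf0) z by rewrite /cartesian_product /= z0 eqxx evz orbT.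
  have eqg : spoke v = g by apply: Msep zg (or_intror Hvz); rewrite // !inE eqxx orbT.
  by move: zg evz; rewrite -eqg => /spoke_mem->; rewrite e_irr.
have eqg : spoke v = g.
  apply: Msep zg (or_intror _) => //; last by rewrite -eqy; exact: Hxy.
  by rewrite !inE eqxx.
move: zg; rewrite -eqg -eqy !inE => /orP[] /eqP yE; rewrite yE in Hxy y0.
  by have := edge_neq Hxy; rewrite eqxx.
by move: y0; rewrite /= ?eqxx.
Qed.

Let folded : {set {set T}} := [set fold @: f | f : {set T} in M].
Let rest := kept_edges :\: folded.
(** Spokes in [M] count too, through the vertex onto which they fold, so the lists reserve their
    colours there. *)
Let meeting (g : {set T}) := [set f in M | ~~ [disjoint fold @: f & g]].
Let free_colors (g : {set T}) := ~: (phi @: meeting g).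

Lemma degree_rest x : #|[set f in rest | x \in f]| <= max_degree e + m.
Proof.
apply: leq_trans (degree_kept x); apply: subset_leq_card; apply/subsetP=> f.
by rewrite !inE => /andP[/andP[_ ->] ->].
Qed.

Lemma degree_rest_lt f x : f \in M -> fold @: f \in kept_edges -> x \in fold @: f ->
  #|[set g in rest | x \in g]| < max_degree e + m.
Proof.
move=> fM fk xf; apply: leq_trans (degree_kept x); apply: proper_card.
apply/properP; split.
  by apply/subsetP=> g; rewrite !inE => /andP[/andP[_ ->] ->].
exists (fold @: f); rewrite inE ?fk ?xf // inE; apply/negP=> /andP[].
by rewrite inE imset_f.
Qed.

Lemma degree_le_incident (p : {set T} -> option T) x :
    (forall f, p f = Some x -> x \in f) ->
  degree p rest (Some x) <= #|[set f in rest | x \in f]|.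
Proof.
move=> px; apply: subset_leq_card; apply/subsetP=> f.
by rewrite !inE => /andP[-> /eqP/px].
Qed.

Lemma free_colors_enough : {in rest, forall g,
  maxn (degree aend rest (aend g)) (degree bend rest (bend g)) <= #|free_colors g|}.
Proof.
move=> g grest; have gk : g \in kept_edges by move: grest; rewrite inE => /andP[].
have gH := subsetP kept_sub _ gk.
have [x [y [Hxy eqg sx sy [x0 y0]]]] := kept_edgeP gk.
have [xg yg] : x \in g /\ y \in g by rewrite eqg !inE !eqxx orbT.
rewrite (aendP gH xg sx) (bendP gH yg sy).
have degx : degree aend rest (Some x) <= #|[set f in rest | x \in f]|.
  by apply: degree_le_incident => f; rewrite /aend; case: pickP => // z /andP[zf _] [<-].
have degy : degree bend rest (Some y) <= #|[set f in rest | y \in f]|.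
  by apply: degree_le_incident => f; rewrite /bend; case: pickP => // z /andP[zf _] [<-].
pose at_ z := [set f in M | z \in fold @: f].
have at_le1 z : #|at_ z| <= 1.
  apply/card_le1_eqP=> f f'; rewrite !inE => /andP[fM zf] /andP[f'M zf'].
  by apply: (fold_uniq (x := z)).
have meet_le : #|meeting g| <= #|at_ x| + #|at_ y|.
  apply: leq_trans (leq_card_setU _ _); apply: subset_leq_card.
  apply/subsetP=> f; rewrite !inE => /andP[fM /meetP[z zf]].
  by rewrite eqg !inE fM => /orP[] /eqP <-; rewrite zf ?orbT.
have free_ge : (max_degree e + m).+1 - #|meeting g| <= #|free_colors g|.
  by rewrite [X in _ <= X]cardsCs setCK card_ord leq_sub2l // leq_imset_card.
have few : #|meeting g| <= 1 -> max_degree e + m <= #|free_colors g|.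
  by move=> le1; apply: leq_trans free_ge; apply: leq_trans (leq_sub2l _ le1);
     rewrite subSS subn0.
have [le1|] := leqP #|meeting g| 1.
  apply: leq_trans (few le1).
  by rewrite geq_max (leq_trans degx) ?(leq_trans degy) ?degree_rest.
(* Now both ends are met by distinct edges of [M], neither a spoke; their images are missing from
   [rest], so both degrees are strictly smaller. *)
move=> gt1; have := leq_trans gt1 meet_le.
have [atx0|/set0Pn[f]] := eqVneq (at_ x) set0.
  by rewrite atx0 cards0 ltnNge at_le1.
have [aty0|/set0Pn[f']] := eqVneq (at_ y) set0.
  by rewrite aty0 cards0 addn0 ltnNge at_le1.
rewrite !inE => /andP[f'M yf'] /andP[fM xf] _.
have fk : fold @: f \in kept_edges.
  have [[v eqf]|//] := fold_edge (subsetP MH _ fM).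
  by rewrite eqf in fM xf; rewrite (negPf (spoke_isolated fM f'M Hxy y0 xf)) in yf'.
have f'k : fold @: f' \in kept_edges.
  have [[v eqf]|//] := fold_edge (subsetP MH _ f'M); rewrite edgeC in Hxy.
  by rewrite eqf in f'M yf'; rewrite (negPf (spoke_isolated f'M fM Hxy x0 yf')) in xf.
have ltx := degree_rest_lt fM fk xf; have lty := degree_rest_lt f'M f'k yf'.
apply: leq_trans free_ge; rewrite geq_max.
have le2 : #|meeting g| <= 2.
  by apply: leq_trans meet_le _; apply: (leq_add (at_le1 x) (at_le1 y)).
have le_sub d : d < max_degree e + m -> d <= (max_degree e + m).+1 - #|meeting g|.
  move=> ltd; apply: leq_trans (leq_sub2l _ le2); rewrite -ltnS.
  by case: (max_degree e + m) ltd => // n; rewrite !subSS subn0.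
by rewrite !le_sub // ?(leq_ltn_trans degx) ?(leq_ltn_trans degy).
Qed.

(** The second clause includes spokes in [M], whose images are not kept edges; it keeps their
    colours available for the unfolding. *)
Lemma kept_coloring : exists c : {set T} -> 'I_(max_degree e + m).+1,
  [/\ forall f : {set T}, f \in M -> fold @: f \in kept_edges -> c (fold @: f) = phi f,
      forall f g : {set T}, f \in M -> g \in kept_edges -> ~~ [disjoint fold @: f & g] ->
        fold @: f != g -> c g != phi f
    & {in kept_edges &, forall f g : {set T}, ~~ [disjoint f & g] -> f != g -> c f != c g}].
Proof.
have [c1 c1L c1P] := bipartite_list_edge_coloring ord0 free_colors_enough.
pose c (g : {set T}) := if [pick f in M | fold @: f == g] is Some f then phi f else c1 g.
have c_fold (f : {set T}) : f \in M -> fold @: f \in kept_edges -> c (fold @: f) = phi f.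
  move=> fM fk; rewrite /c; case: pickP => [g /andP[gM /eqP eqgf]|/(_ f)]; last first.
    by rewrite fM eqxx.
  have [x [y [_ eqf _ _ _]]] := kept_edgeP fk.
  by rewrite (@fold_uniq f g x) // ?eqgf eqf !inE eqxx.
have c_rest (g : {set T}) : g \in rest -> c g = c1 g.
  move=> grest; rewrite /c; case: pickP => // f /andP[fM /eqP eqf].
  by move: grest; rewrite inE -eqf imset_f.
have c_avoid (f g : {set T}) :
    f \in M -> g \in kept_edges -> ~~ [disjoint fold @: f & g] ->
    fold @: f != g -> c g != phi f.
  move=> fM gk meet ne; have [/imsetP[f' f'M eqg]|gr] := boolP (g \in folded).
    have /meetP[x xf xg] := meet; rewrite eqg in xg ne.
    by rewrite (fold_uniq fM f'M xf xg) eqxx in ne.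
  have grest : g \in rest by rewrite inE gr.
  rewrite c_rest //; have := c1L g grest; rewrite inE; apply: contraNneq => ->.
  by apply: imset_f; rewrite inE fM.
exists c; split=> // f g fk gk meet ne.
have [/imsetP[f' f'M eqf]|fr] := boolP (f \in folded).
  by rewrite eqf c_fold -?eqf // eq_sym c_avoid -?eqf.
have [/imsetP[g' g'M eqg]|gr] := boolP (g \in folded).
  by rewrite eqg c_fold -?eqg // c_avoid -?eqg // 1?disjoint_sym // eq_sym.
have frest : f \in rest by rewrite inE fr.
have grest : g \in rest by rewrite inE gr.
rewrite !c_rest //; apply: contra_neq ne; apply: c1P => //.
have /meetP[x xf xg] := meet.
have fH := subsetP kept_sub _ fk; have gH := subsetP kept_sub _ gk.
have [sx|sx] := boolP (side x); first by left; rewrite (aendP fH xf) // (aendP gH xg).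
by right; rewrite (bendP fH xf) // (bendP gH xg).
Qed.

Lemma merged_extension : exists c : {set T} -> 'I_(max_degree e + m).+1,
  {in M, c =1 phi} /\
  {in edge_set H &, forall f g : {set T}, f != g -> ~~ [disjoint f & g] -> c f != c g}.
Proof.
have [c0 [c0M c0avoid c0P]] := kept_coloring.
pose used v := c0 @: [set f in kept_edges | (v, None) \in f].
(* Some colour is always missing from [used v], since the palette is larger than the number of kept
   edges at [(v, None)]. *)
pose s v := if spoke v \in M then phi (spoke v)
  else odflt ord0 [pick j | j \notin used v].
have s_avoid v (f : {set T}) : f \in kept_edges -> (v, None) \in f -> c0 f != s v.
  move=> fk vf; rewrite /s; case: ifPn => vM.
    apply: c0avoid => //; rewrite fold_spoke.
      by apply/meetP; exists (v, None); rewrite // inE.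
    have [x [y [Hxy -> _ _ _]]] := kept_edgeP fk.
    apply/negP=> /eqP/setP eqv; have := edge_neq Hxy.
    have := eqv x; have := eqv y; rewrite !inE !eqxx orbT => /eqP-> /eqP->.
    by rewrite eqxx.
  case: pickP => [j jn|all_used] /=.
    by apply: contraNneq jn => <-; apply: imset_f; rewrite inE fk.
  have : #|'I_(max_degree e + m).+1| <= #|used v|.
    apply: subset_leq_card; apply/subsetP=> j _; apply/negPn; by rewrite all_used.
  rewrite card_ord ltnNge; case/negP.
  exact: leq_trans (leq_imset_card _ _) (degree_kept _).
have spoke_inj v w : spoke v = spoke w -> v = w.
  by move=> eqvw; have := @spoke_mem w (v, None); rewrite -eqvw !inE eqxx => /(_ isT).
pose c (f : {set T}) := if [pick v | f == spoke v] is Some v then s v else c0 (fold @: f).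
have c_spoke v : c (spoke v) = s v.
  rewrite /c; case: pickP => [w /eqP/spoke_inj-> //|/(_ v)]; by rewrite eqxx.
have c_fold (f : {set T}) : f \in edge_set H -> (exists v, f = spoke v) \/
    fold @: f \in kept_edges /\ c f = c0 (fold @: f).
  move=> fH; rewrite /c; case: pickP => [v /eqP->|nspoke]; first by left; exists v.
  right; have [[v eqf]|//] := fold_edge fH.
  by have := nspoke v; rewrite eqf eqxx.
exists c; split=> [f fM|f g fH gH ne /meetP[x xf xg]].
  have [[v eqf]|[fk ->]] := c_fold f (subsetP MH _ fM); last exact: c0M.
  by rewrite eqf in fM *; rewrite c_spoke /s fM.
have spoke_meets v (h : {set T}) : h \in edge_set H -> fold @: h \in kept_edges ->
    x \in spoke v -> x \in h -> (v, None) \in fold @: h.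
  move=> hH hk xv xh; apply/imsetP; exists x => //.
  by move: xv; rewrite !inE => /orP[] /eqP->; rewrite /fold /= ?eqxx.
have [[v eqf]|[fk cf]] := c_fold f fH; have [[w eqg]|[gk cg]] := c_fold g gH.
- rewrite eqf eqg in xf xg ne.
  by rewrite -(spoke_mem xf) -(spoke_mem xg) eqxx in ne.
- by rewrite eqf in xf *; rewrite c_spoke cg eq_sym s_avoid // spoke_meets.
- by rewrite eqg in xg *; rewrite c_spoke cf s_avoid // spoke_meets.
rewrite cf cg c0P //.
  by apply/meetP; exists (fold x); apply: imset_f.
(* Two edges at [x] with equal images lead to vertices with equal folds; if these differed they
   would be adjacent and close a triangle, impossible in a bipartite graph. *)
apply: contra_neq ne => eqfg.
have other (h : {set T}) :
    h \in edge_set H -> x \in h -> exists2 y, H x y & h = [set x; y].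
  case/edge_setP=> y [z [Hyz -> _ _]]; rewrite !inE => /orP[] /eqP->; first by exists z.
  by exists y; rewrite 1?edgeC // setUC.
have [y Hxy eqf] := other f fH xf; have [z Hxz eqg] := other g gH xg.
suff eqyz : fold y = fold z.
  case: (fold_inj eqyz) => [yz|Hyz]; first by rewrite eqf eqg yz.
  have := edge_side Hxy; have := edge_side Hxz; have := edge_side Hyz.
  by case: (side x) (side y) (side z) => [] [] [].
have not_loop (h : {set T}) w :
    fold @: h \in kept_edges -> h = [set x; w] -> fold w != fold x.
  move=> /kept_edgeP[u [u' [Huu' eqh _ _ _]]] h_eq.
  apply: contra_neq (edge_neq Huu') => wx.
  move: eqh; rewrite h_eq imsetU1 imset_set1 wx setUid => /setP eqh.
  by have := eqh u; have := eqh u'; rewrite !inE !eqxx orbT => /eqP-> /eqP->.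
have : fold y \in fold @: g by rewrite -eqfg imset_f // eqf !inE eqxx orbT.
rewrite eqg imsetU1 imset_set1 !inE => /orP[/eqP yx|/eqP//].
by have := not_loop f y fk eqf; rewrite yx eqxx.
Qed.

End Extension.

End MergedLeaf.

(** * The chromatic index of the product *)

Lemma degree_le_edge_colorable (T : finType) (e : rel T) n x :
  edge_colorable e n -> #|[set y | e x y]| <= n.
Proof.
move=> /existsP[c /andP[/forall_inP c_range /forall_inP c_proper]].
pose S := [set [set x; y] | y in [set y | e x y]].
have SE f : f \in S -> f \in edge_set e /\ x \in f.
  move=> /imsetP[y]; rewrite inE => exy ->; rewrite !inE eqxx; split=> //.
  by apply/imsetP; exists (x, y); rewrite ?inE.
have inj2 : {in [set y | e x y] &, injective (fun y => [set x; y])}.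
  move=> y z _ _ /setP eqyz; have := eqyz y; have := eqyz z; rewrite !inE !eqxx !orbT.
  case: (eqVneq y x) => [->|yx] /=; first by rewrite orbb => /eqP.
  by move=> _ /esym/eqP.
have injc : {in S &, injective c}.
  move=> f g /SE[fE xf] /SE[gE xg] eqc; apply: contraTeq isT => ne.
  have meet : ~~ [disjoint f & g].
    by rewrite -setI_eq0; apply/set0Pn; exists x; rewrite inE xf.
  by have /forall_inP/(_ g gE) := c_proper f fE; rewrite ne meet eqc eqxx.
rewrite -(card_in_imset inj2) -/S -(card_in_imset injc).
apply: (@leq_trans #|[set~ (ord0 : 'I_n.+1)]|); last by rewrite cardsC1 card_ord.
apply: subset_leq_card; apply/subsetP=> _ /imsetP[f /SE[fE _] ->].
by rewrite !inE -val_eqE /= -lt0n; case/andP: (c_range f fE).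
Qed.

Lemma chromatic_index_eq (T : finType) (e : rel T) k x :
  edge_colorable e k -> k <= #|[set y | e x y]| -> chromatic_index e = k.
Proof.
move=> colk lek; rewrite /chromatic_index; case: ex_minnP => n coln minn.
apply/eqP; rewrite eqn_leq minn //=.
exact: leq_trans lek (degree_le_edge_colorable x coln).
Qed.

(** For [v] of maximum degree this gives the lower bound on the chromatic index. *)
Lemma degree_centre (V : finType) (e : rel V) m v :
  #|[set y | cartesian_product e (star m) (v, None) y]| = #|[set u | e v u]| + m.
Proof.
have injl : injective (fun u : V => (u, None : option 'I_m)) by move=> u w [].
have injr : injective (fun i : 'I_m => (v, Some i)) by move=> i j [].
rewrite -(card_imset _ injl) -[X in _ + X]card_ord -cardsT -(card_imset _ injr).
rewrite -cardsUI (_ : _ :&: _ = set0) ?cards0 ?addn0; last first.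
  by apply/setP=> -[u o]; rewrite !inE; apply/negP=> /andP[/imsetP[? _ [_ ->]] /imsetP[]].
apply: eq_card => -[u o]; rewrite !inE /cartesian_product /star /=.
apply/idP/orP=> [/orP[/andP[/eqP<-]|/andP[/eqP<- evu]]|[]].
- by case: o => [i|] //= _; right; apply/imsetP; exists i.
- by left; apply/imsetP; exists u; rewrite ?inE.
- by case/imsetP=> w; rewrite inE => evw [-> ->]; rewrite evw !orbT.
- by case/imsetP=> i _ [-> ->]; rewrite eqxx.
Qed.

Theorem theorem4 (V : finType) (e : rel V) (m : nat)
    (M : {set {set V * option 'I_m}}) (phi : {set V * option 'I_m} -> nat)
    (H := cartesian_product e (star m)) :
  simple_graph e -> bipartite e -> 1 <= m ->
  M \subset edge_set H ->
  (forall f g, f \in M -> g \in M -> f != g -> 2 <= edge_dist H f g) ->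
  (forall f, f \in M -> 1 <= phi f <= max_degree e + m) ->
  (exists c : {set V * option 'I_m} -> nat,
     proper_edge_coloring H (max_degree e + m) c /\
     (forall f, f \in M -> c f = phi f)) /\
  (0 < #|V| -> chromatic_index H = max_degree e + m).
Proof.
move=> [e_sym e_irr] [A e_bip]; rewrite {}/H.
case: m M phi => // m M phi _ MH Mdist phi_range.
set H := cartesian_product e (star m.+1) in MH Mdist *.
(* Colours are shifted down by one to become ordinals starting at 0; the final colouring shifts them
   back. *)
pose phi' f : 'I_(max_degree e + m).+1 := inord (phi f).-1.
have phi'E f : f \in M -> (phi' f).+1 = phi f.
  move=> /phi_range/andP[phi_gt0 phi_le]; rewrite inordK ?prednK //.
  by rewrite -addnS.
have Msep f g x z : f \in M -> g \in M -> x \in f -> z \in g ->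
    x = z \/ H x z -> f = g.
  move=> fM gM xf zg xz; apply: contraTeq isT => ne.
  have [xz' Hxz] := edge_dist_gt1 (Mdist f g fM gM ne) xf zg.
  by case: xz => [eqxz|Hxz']; [rewrite eqxz eqxx in xz' | rewrite Hxz' in Hxz].
have [c [cM cP]] := merged_extension e_sym e_irr e_bip phi' MH Msep.
have c_proper : proper_edge_coloring H (max_degree e + m.+1) (fun f => (c f).+1).
  apply/andP; split; first by apply/forall_inP=> f _; rewrite addnS ltn_ord.
  apply/forall_inP=> f fH; apply/forall_inP=> g gH; apply/implyP=> /andP[ne meet].
  by rewrite eqSS; apply: cP.
split; first by exists (fun f => (c f).+1); split=> // f fM; rewrite cM // phi'E.
move=> V_gt0; have [v dv] := eq_bigmax (fun x => #|[set y | e x y]|) V_gt0.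
apply: (@chromatic_index_eq _ _ _ (v, None)); last first.
  by rewrite degree_centre -dv.
apply/existsP; exists [ffun f => inord (c f).+1].
move: c_proper; rewrite /proper_edge_coloring => /andP[/forall_inP rng /forall_inP prop].
have cE f : f \in edge_set H ->
    ([ffun f => inord (c f).+1] : {ffun _ -> 'I_(max_degree e + m.+1).+1}) f = (c f).+1 :> nat.
  by move=> /rng/andP[_ le]; rewrite ffunE inordK.
apply/andP; split; first by apply/forall_inP=> f fH; rewrite cE // rng.
apply/forall_inP=> f fH; apply/forall_inP=> g gH; rewrite !cE //.
by have /forall_inP/(_ g gH) := prop f fH.
Qed.
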